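(* Suppose $X$ and $Y$ are compact Hausdorff spaces, $Y$ is scattered, $f : X \to Y$ is continuous, and $f^{-1}\{y\} \in MS$ for every $y \in Y$. Then $X \in MS$.
   Context: All spaces are Hausdorff. $MS$ is the class of compact Hausdorff spaces $X$ such that every Radon measure (finite regular Borel measure) on $X$ is separable, where a measure is separable iff its measure algebra (Borel sets modulo null sets, with metric $d(A,B)=\mu(A\triangle B)$) is separable as a metric space. *)

(* Defs.v *)
From HB Require Import structures.
From mathcomp Require Import all_boot all_order all_algebra.
From mathcomp Require Import all_classical all_reals all_analysis.

Set Implicit Arguments.
Unset Strict Implicit.
Unset Printing Implicit Defensive.

Import Order.TTheory GRing.Theory Num.Theory.

Local Open Scope classical_set_scope.
Local Open Scope ring_scope.

Definition scattered (T : topologicalType) : Prop :=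
  forall A : set T, A !=set0 -> isolated A !=set0.

Definition separable_space (T : topologicalType) : Prop :=
  exists2 D : set T, countable D & dense D.

(* The library's measurable types are pointed, whereas topological spaces may
   be empty (so may the fibres of a continuous map). [borelType x0] is X with
   its Borel sigma-algebra and an arbitrary base point x0; the sigma-algebra
   does not depend on x0. *)
Definition pointed_at (X : topologicalType) (x0 : X) : Type := X.

HB.instance Definition _ (X : topologicalType) (x0 : X) :=
  Choice.copy (pointed_at x0) X.
HB.instance Definition _ (X : topologicalType) (x0 : X) :=
  isPointed.Build (pointed_at x0) x0.

Definition borelType (X : topologicalType) (x0 : X) :=
  @g_sigma_algebraType (pointed_at x0) (@open X).

Section regularity.
Local Open Scope ereal_scope.

Definition regular_measure (R : realType) (X : topologicalType) (x0 : X)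
    (mu : {finite_measure set (borelType x0) -> \bar R}) : Prop :=
  forall A : set (borelType x0), measurable A ->
    mu A = ereal_sup [set mu K | K in [set K : set X | compact K /\ K `<=` A]]
    /\ mu A = ereal_inf [set mu U | U in [set U : set X | open U /\ A `<=` U]].

End regularity.

Section measure_algebra.
Context (R : realType) (d : measure_display) (T : measurableType d).
Variable mu : {finite_measure set T -> \bar R}.

Definition meas_set : Type := set_type (@measurable d T).

Definition meas_dist (A B : meas_set) : R :=
  fine (mu (set_val A `+` set_val B)).

Let mmeasY (A B : meas_set) : measurable (set_val A `+` set_val B).
Proof.
by rewrite setY_def; apply: measurableU; apply: measurableD; exact: set_valP.
Qed.

Lemma meas_dist_ge0 A B : 0 <= meas_dist A B.
Proof. exact: fine_ge0. Qed.

Lemma meas_distxx A : meas_dist A A = 0.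
Proof. by rewrite /meas_dist setYK measure0. Qed.

Lemma meas_dist_sym A B : meas_dist A B = meas_dist B A.
Proof. by rewrite /meas_dist setYC. Qed.

Lemma meas_dist_triangle B A C :
  meas_dist A C <= meas_dist A B + meas_dist B C.
Proof.
rewrite /meas_dist -fineD ?fin_num_measure//.
apply: fine_le; rewrite ?fin_numD ?fin_num_measure//.
apply: le_trans (measureU2 _ _ _); [|exact: mmeasY|exact: mmeasY].
apply: le_measure; rewrite ?inE; [exact: mmeasY| |].
  by apply: measurableU; exact: mmeasY.
move=> x; rewrite !setY_def => -[[Ax nCx]|[Cx nAx]].
- by have [Bx|nBx] := pselect (set_val B x); [right; left|left; left].
- by have [Bx|nBx] := pselect (set_val B x); [left; right|right; right].
Qed.

Definition ae_eq_set : rel meas_set := fun A B => meas_dist A B == 0.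

Let ae_eq_set_refl : reflexive ae_eq_set.
Proof. by move=> A; rewrite /ae_eq_set meas_distxx. Qed.

Let ae_eq_set_sym : symmetric ae_eq_set.
Proof. by move=> A B; rewrite /ae_eq_set meas_dist_sym. Qed.

Let ae_eq_set_trans : transitive ae_eq_set.
Proof.
move=> B A C /eqP AB /eqP BC; rewrite /ae_eq_set eq_le meas_dist_ge0 andbT.
by rewrite (le_trans (meas_dist_triangle B A C))// AB BC addr0.
Qed.

Canonical ae_eq_set_equiv := EquivRel ae_eq_set
  ae_eq_set_refl ae_eq_set_sym ae_eq_set_trans.

Definition measure_algebra : Type := {eq_quot ae_eq_set}%qT.
HB.instance Definition _ := Choice.on measure_algebra.

Definition mclass (A : meas_set) : measure_algebra :=
  (\pi_({eq_quot ae_eq_set}) A)%qT.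

Definition measure_algebra_dist (a b : measure_algebra) : R :=
  meas_dist (repr (a : {eq_quot ae_eq_set}%qT))
           (repr (b : {eq_quot ae_eq_set}%qT)).

Let repr_mclass (A : meas_set) :
  meas_dist (repr (mclass A : {eq_quot ae_eq_set}%qT)) A = 0.
Proof. by apply/eqP; have /eqmodP := reprK (mclass A). Qed.

(* The distance on classes does not depend on the representatives. *)
Lemma measure_algebra_distE A B :
  measure_algebra_dist (mclass A) (mclass B) = meas_dist A B.
Proof.
rewrite /measure_algebra_dist.
have := repr_mclass B; have := repr_mclass A.
set A' := repr _ => HA; set B' := repr _ => HB; apply/eqP; rewrite eq_le.
apply/andP; split.
- rewrite (le_trans (meas_dist_triangle A _ _))// HA add0r.
  by rewrite (le_trans (meas_dist_triangle B _ _))// (meas_dist_sym B) HB addr0.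
- rewrite (le_trans (meas_dist_triangle A' _ _))// (meas_dist_sym A) HA add0r.
  by rewrite (le_trans (meas_dist_triangle B' _ _))// HB addr0.
Qed.

Let distxx a : measure_algebra_dist a a = 0.
Proof. exact: meas_distxx. Qed.

Let dist_pos a b : measure_algebra_dist a b = 0 -> a = b.
Proof.
move=> ab0; rewrite -[LHS](@reprK _ {eq_quot ae_eq_set}%qT).
rewrite -[RHS](@reprK _ {eq_quot ae_eq_set}%qT).
by apply/eqmodP; apply/eqP.
Qed.

Let dist_sym a b : measure_algebra_dist a b = measure_algebra_dist b a.
Proof. exact: meas_dist_sym. Qed.

Let dist_triangle b a c :
  measure_algebra_dist a c <=
  measure_algebra_dist a b + measure_algebra_dist b c.
Proof. exact: meas_dist_triangle. Qed.

HB.instance Definition _ := @isMetric.Build R measure_algebra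
  measure_algebra_dist distxx dist_pos dist_sym dist_triangle.

Definition separable_measure : Prop := separable_space measure_algebra.

End measure_algebra.

(* For empty X the quantifier over x0 is vacuous: the only measure on the empty
   space is zero, and its measure algebra is a single point. *)
Definition MS (R : realType) (X : topologicalType) : Prop :=
  [/\ compact [set: X], hausdorff_space X &
      forall (x0 : X) (mu : {finite_measure set (borelType x0) -> \bar R}),
        regular_measure mu -> separable_measure mu].

(* Main.v *)
From HB Require Import structures.
Require Import Defs.
From mathcomp Require Import all_boot all_order all_algebra.
From mathcomp Require Import all_classical all_reals all_analysis.

Set Implicit Arguments.
Unset Strict Implicit.
Unset Printing Implicit Defensive.

(* Let mu be a Radon measure on X. Since Y is scattered, the part of mu living
   outside the fibres of positive measure vanishes: an isolated point y of the
   support of its image would have a neighbourhood whose preimage is null off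
   the fibre of y, and that fibre is null too. So mu is carried by countably
   many fibres. On each of them the trace of mu is a Radon measure, hence
   separable; finite unions of members of the corresponding countable dense
   families of Borel sets are dense in the measure algebra of mu. *)

Import Order.TTheory GRing.Theory Num.Theory.

Local Open Scope classical_set_scope.
Local Open Scope ring_scope.
Local Open Scope ereal_scope.

(** * Approximation of measurable sets and separability of finite measures *)

Section approximation.
Context (R : realType) (d : measure_display) (T : measurableType d).
Variable mu : {finite_measure set T -> \bar R}.
Implicit Types (A B : set T) (C : set (set T)).

(** Closure in the metric of the measure algebra, phrased on sets so that later arguments avoid the
    quotient. *)
Definition approximable C A : Prop :=
  forall e : R, (0 < e)%R -> exists2 B, C B & mu (A `+` B) < e%:E.

Lemma measurable_setY A B :
  measurable A -> measurable B -> measurable (A `+` B).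
Proof.
by move=> mA mB; rewrite setY_def; apply: measurableU; exact: measurableD.
Qed.

Lemma measure_setY_triangle B A D :
  measurable A -> measurable B -> measurable D ->
  mu (A `+` D) <= mu (A `+` B) + mu (B `+` D).
Proof.
move=> mA mB mD.
apply: le_trans (measureU2 _ _ _);
  [|exact: measurable_setY|exact: measurable_setY].
apply: le_measure; rewrite ?inE; [exact: measurable_setY| |].
  by apply: measurableU; exact: measurable_setY.
move=> x; rewrite !setY_def => -[[Ax nCx]|[Cx nAx]].
- by have [Bx|nBx] := pselect (B x); [right; left|left; left].
- by have [Bx|nBx] := pselect (B x); [left; right|right; right].
Qed.

Lemma approximable_lim C A : C `<=` measurable -> measurable A ->
  (forall e : R, (0 < e)%R ->
    exists2 B, measurable B /\ approximable C B & mu (A `+` B) < e%:E) ->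
  approximable C A.
Proof.
move=> mC mA AB e e0; have e20 : (0 < e / 2)%R by rewrite divr_gt0.
have [B [mB CB] ABe] := AB _ e20; have [D CD BDe] := CB _ e20.
exists D => //; apply: le_lt_trans (measure_setY_triangle mA mB (mC _ CD)) _.
by rewrite [e]splitr EFinD lteD.
Qed.

(** The symmetric difference of two unions lies in the union of the two symmetric differences, so
    the errors add up. *)
Lemma approximableU C A B : C `<=` measurable -> setU_closed C ->
  measurable A -> measurable B ->
  approximable C A -> approximable C B -> approximable C (A `|` B).
Proof.
move=> mC UC mA mB CA CB e e0; have e20 : (0 < e / 2)%R by rewrite divr_gt0.
have [A' CA' AA'] := CA _ e20; have [B' CB' BB'] := CB _ e20.
have mA' := mC _ CA'; have mB' := mC _ CB'.
exists (A' `|` B'); first exact: UC.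
rewrite [e]splitr EFinD; apply: le_lt_trans (lteD AA' BB').
apply: le_trans (measureU2 _ _ _);
  [|exact: measurable_setY|exact: measurable_setY].
apply: le_measure; rewrite ?inE.
- by apply: measurable_setY; exact: measurableU.
- by apply: measurableU; exact: measurable_setY.
- by move=> x; rewrite !setY_def /= => -[[[]]|[[]]] + /not_orP[]; tauto.
Qed.

(** Representatives of a countable dense set of classes form such a family [C]; conversely the
    classes of its members are dense. *)
Lemma separable_measureP :
  separable_measure mu <->
  exists C, [/\ countable C, C `<=` measurable &
    forall A, measurable A -> approximable C A].
Proof.
split=> [[D cD dD]|[C [cC mC CA]]].
- pose r (a : measure_algebra mu) :=
    set_val (repr (a : {eq_quot ae_eq_set mu}%qT)) : set T.
  exists (r @` D); split.
  + exact: sub_countable (card_image_le _ _) cD.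
  + by move=> _ [a _ <-]; exact: set_valP.
  move=> A mA e e0; pose A' : meas_set T := SigSub (mem_set mA).
  (* Density is tested on open sets, hence the interior of the ball; it still contains the
     centre. *)
  have oO : open (interior (ball (mclass mu A') e)) by exact: open_interior.
  have [|b [/interior_subset bAe Db]] := dD _ _ oO.
    by exists (mclass mu A'); exact: nbhsx_ballx.
  exists (r b); first by exists b.
  move: bAe; rewrite ballEmdist /=.
  rewrite -[X in mdist _ X](@reprK _ {eq_quot ae_eq_set mu}%qT).
  rewrite [mdist _ _](measure_algebra_distE mu A'
    (repr (b : {eq_quot ae_eq_set mu}%qT))).
  rewrite /meas_dist -lte_fin fineK//.
  by apply: fin_num_measure; apply: measurable_setY => //; exact: set_valP.
(* The empty set is a default for nonmeasurable arguments; this case never occurs on [C]. *)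
- pose g A : measure_algebra mu := if pselect (measurable A) is left mA
    then mclass mu (SigSub (mem_set mA))
    else mclass mu (SigSub (mem_set measurable0)).
  exists (g @` C); first exact: sub_countable (card_image_le _ _) cC.
  move=> O [a Oa] oO.
  have /nbhs_ballP[e /= e0 aeO] : nbhs a O by exact: open_nbhs_nbhs.
  pose A := repr (a : {eq_quot ae_eq_set mu}%qT).
  have [B CB ABe] := CA _ (set_valP A) _ e0.
  exists (g B); split; last by exists B.
  apply: aeO; rewrite ballEmdist /=.
  rewrite -[X in mdist X _](@reprK _ {eq_quot ae_eq_set mu}%qT).
  rewrite /g; case: pselect => [mB|/(_ (mC _ CB))//].
  rewrite [mdist _ _](measure_algebra_distE mu A (SigSub (mem_set mB))).
  rewrite /meas_dist -lte_fin fineK//.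
  by apply: fin_num_measure; apply: measurable_setY => //; exact: set_valP.
Qed.

(** Cutting [A] down to the first pieces leaves a remainder that decreases to a null set, so finite
    unions of approximations on single pieces suffice. *)
Lemma separable_measure_cover (P : (set T)^nat) :
  (forall n, measurable (P n)) -> mu (~` \bigcup_n P n) = 0 ->
  (forall n, exists C, [/\ countable C, C `<=` measurable &
     forall A, measurable A -> A `<=` P n -> approximable C A]) ->
  separable_measure mu.
Proof.
move=> mP P0 /choice[C CP]; apply/separable_measureP.
pose U := \bigcup_n C n.
have cU : countable U by apply: bigcup_countable => // n _; case: (CP n).
have mU : U `<=` measurable by move=> A [n _ CnA]; have [_ + _] := CP n; exact.
(* Finite unions of members of [U]: still countably many, and now closed under union. *)
pose D := (fun S : set (set T) => \bigcup_(B in S) B) @`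
  [set S | S `<=` U /\ finite_set S].
have mD : D `<=` measurable.
  move=> _ [S [SU fS] <-]; apply: fin_bigcup_measurable => // B SB.
  exact/mU/SU.
have D0 : D set0.
  by exists set0; [split => //; exact: finite_set0|rewrite bigcup_set0].
have DU : setU_closed D.
  move=> _ _ [S [SU fS] <-] [S' [SU' fS'] <-].
  exists (S `|` S'); last exact: bigcup_setU.
  by split; [move=> B [/SU|/SU']|rewrite finite_setU].
exists D; split => //.
  exact: sub_countable (card_image_le _ _) (countable_finite_subset cU).
move=> A mA.
pose F n := A `&` \big[setU/set0]_(i < n) P i.
have mF n : measurable (F n).
  by apply: measurableI => //; exact: bigsetU_measurable.
have DF n : approximable D (F n).
  elim: n => [|n IH]; rewrite /F.
    rewrite big_ord0 setI0 => e e0; exists set0 => //.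
    by rewrite setYK measure0 lte_fin.
  rewrite big_ord_recr/= setIUr.
  apply: approximableU => //; [exact: mF|exact: measurableI|].
  move=> e e0; have [_ _ /(_ _ (measurableI _ _ mA (mP n)))] := CP n.
  move=> /(_ (@subIsetr _ _ _) _ e0)[B CB ABe]; exists B => //.
  exists [set B]; last by rewrite bigcup_set1.
  by split; [move=> _ ->; exists n|exact: finite_set1].
apply: approximable_lim => // e e0.
pose G n := A `\` F n.
have mG n : measurable (G n) by exact: measurableD.
have G0 : mu (\bigcap_n G n) = 0.
  apply: (@subset_measure0 _ _ _ mu _ (~` \bigcup_n P n)) => //.
  - exact: bigcap_measurable.
  - by apply: measurableC; exact: bigcup_measurable.
  (* [F n] stops just before piece [n], so [n.+1] is the index at which [P n] is surely included. *)
  move=> x Gx [n _ Pnx]; have [Ax nFx] := Gx n.+1 I; apply: nFx; split => //.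
  by rewrite big_ord_recr; right.
have niG : {homo G : n m / (n <= m)%N >-> (m <= n)%O}.
  move=> n m nm; apply/subsetPset => x [Ax nFx]; split=> // -[_ Px].
  by apply: nFx; split=> //; apply: subset_bigsetU Px.
(* Continuity from above, available because [mu] is finite. *)
have : mu (G n) @[n --> \oo] --> 0.
  rewrite -G0; apply: nonincreasing_cvg_mu => //.
    by rewrite -ge0_fin_numE// fin_num_measure.
  exact: bigcap_measurable.
move=> /fine_cvgP[_ /cvgrPdist_lt/(_ _ e0)[N _ /(_ N (leqnn N))/=]].
rewrite sub0r normrN ger0_norm ?fine_ge0// => GNe.
have AF : A `+` F N = G N by rewrite /G /F setYD setDIr setDv set0U.
by exists (F N) => //; rewrite AF -[mu _]fineK ?lte_fin// fin_num_measure.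
Qed.

(** By disjointness and finite total mass, only finitely many pieces have measure above a given
    [n.+1%:R^-1]. *)
Lemma countable_positive_measure (I : choiceType) (P : I -> set T) :
  (forall i, measurable (P i)) -> trivIset setT P ->
  countable [set i | 0 < mu (P i)].
Proof.
elim/choicePpointed: I => I in P *.
  by move=> _ _; rewrite [X in countable X]empty_eq0; exact: countable0.
move=> mP tP; have muP i : mu (P i) = (fine (mu (P i)))%:E.
  by rewrite fineK// fin_num_measure.
have -> : [set i | 0 < mu (P i)] =
    \bigcup_n [set i | (n.+1%:R^-1 < fine (mu (P i)))%R].
  apply/seteqP; split=> i /=; rewrite muP.
    by rewrite lte_fin => /ltr_add_invr[k /[!add0r] kPi]; exists k.
  by move=> [n _ /= nPi]; rewrite lte_fin; apply: lt_trans nPi.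
apply: bigcup_countable => // n _; apply: finite_set_countable.
apply: contrapT => /infiniteP/pcard_leP/injfunPex[/= q q_fun q_inj].
(* [k] exceeds [n.+1] times the total mass, so [k] disjoint pieces of measure above [n.+1%:R^-1]
   would weigh more than the whole space. *)
pose k := (Num.truncn (fine (mu setT) * n.+1%:R)).+1.
have : mu (\bigcup_k P (q k)) <= mu setT.
  by apply: le_measure; rewrite ?inE//; exact: bigcup_measurable.
rewrite leNgt => /negP; apply.
have -> : mu (\bigcup_k P (q k)) = \sum_(0 <= k <oo) mu (P (q k)).
  rewrite measure_bigcup//; first by apply: eq_eseriesl => // i; rewrite in_setT.
  apply/trivIsetP => i j _ _ ij; move/trivIsetP : tP; apply => //.
  by apply: contra_neq ij => /q_inj; apply; rewrite inE.
apply: (lt_le_trans _ (nneseries_lim_ge k _)) => //.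
apply: (@lt_le_trans _ _ (\sum_(0 <= i < k) (n.+1%:R^-1)%:E)).
  rewrite sumEFin sumr_const_nat subn0 -[mu _]fineK ?fin_num_measure// lte_fin.
  by rewrite -[ltRHS]mulr_natl ltr_pdivlMr// truncnS_gt.
by apply: lee_sum => i _; rewrite muP lee_fin ltW//; exact: q_fun.
Qed.
End approximation.

(** * Borel sets of a space and of its closed subspaces *)

Section borel.
Context (X : topologicalType) (x0 : X).

Lemma open_borel (U : set X) : open U -> measurable (U : set (borelType x0)).
Proof. exact: sub_sigma_algebra. Qed.

Lemma closed_borel (F : set X) : closed F -> measurable (F : set (borelType x0)).
Proof.
move=> cF; rewrite -[F]setCK; apply: (@measurableC _ (borelType x0)).
by apply: open_borel; rewrite openC.
Qed.

(** The sets with Borel image form a sigma-algebra: by injectivity of the inclusion, complements go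
    to complements within [F], which is Borel. It contains the open sets of the subspace, these
    being traces of open sets of [X]. *)
Lemma borel_image_set_val (F : set X) (z0 : set_type F) (B : set (set_type F)) :
  closed F -> measurable (B : set (borelType z0)) ->
  measurable (set_val @` B : set (borelType x0)).
Proof.
move=> cF; have mF := closed_borel cF.
have imE (V : set X) : set_val @` (set_val @^-1` V : set (set_type F)) = F `&` V.
  apply/seteqP; split=> [_ [x Vx <-]|x [Fx Vx]].
    by split => //; exact: set_valP.
  by exists (SigSub (mem_set Fx)).
apply: (@smallest_sub _ _ _
  [set B | measurable (set_val @` B : set (borelType x0))]).
- split=> /= [|A mA|A mA].
  + by rewrite image_set0.
  + rewrite (_ : set_val @` _ = F `\` set_val @` A); first exact: measurableD.
    apply/seteqP; split=> [_ [x [_ nAx] <-]|x [Fx nAx]].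
      split; first exact: set_valP.
      by move=> [y Ay /val_inj yx]; rewrite -yx in nAx.
    exists (SigSub (mem_set Fx)) => //; split => // Ax; apply: nAx.
    by exists (SigSub (mem_set Fx)).
  + by rewrite image_bigcup; exact: bigcup_measurable.
- move=> _ [V oV <-] /=; rewrite imE; apply: measurableI => //.
  exact: open_borel.
Qed.

Lemma borel_preimage_set_val (F : set X) (z0 : set_type F) (A : set X) :
  measurable (A : set (borelType x0)) ->
  measurable (set_val @^-1` A : set (borelType z0)).
Proof.
apply: (@smallest_sub _ _ _
  [set A | measurable (set_val @^-1` A : set (borelType z0))]).
- split=> /= [|B mB|B mB].
  + by rewrite preimage_set0.
  + by rewrite setTD preimage_setC; exact: (@measurableC _ (borelType z0)).
  + by rewrite preimage_bigcup; exact: (@bigcup_measurable _ (borelType z0)).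
- by move=> V oV /=; apply: sub_sigma_algebra; exists V.
Qed.

End borel.

(** * Null sets of a regular measure *)

Section regular.
Context (R : realType) (X : topologicalType) (x0 : X).
Variable mu : {finite_measure set (borelType x0) -> \bar R}.
Hypotheses (hX : hausdorff_space X) (rmu : regular_measure mu).

(** Inner regularity reduces the claim to compact subsets of [A]. Countable additivity alone would
    not do, as the open sets [U] may be uncountably many. *)
Lemma locally_null (A : set X) : measurable (A : set (borelType x0)) ->
  (forall x, A x -> exists U, [/\ open U, U x & mu (A `&` U) = 0]) ->
  mu A = 0.
Proof.
move=> mA nA; have [-> _] := rmu mA.
apply/eqP; rewrite eq_le; apply/andP; split; last first.
  apply: ereal_sup_ubound; exists set0; last exact: measure0.
  by split => //; exact: compact0.
apply: ge_ereal_sup => _ [K [cK KA] <-].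
(* The null open sets are directed, so a compact set covered by them lies in a
   single one: near-covering compactness for the filter of their supersets. *)
pose N := [set V : set X | open V /\ mu (A `&` V) = 0].
pose NF := filter_from N (fun V => [set W : set X | V `<=` W]).
have FNF : Filter NF.
  apply: filter_from_filter.
    by exists set0; split; [exact: open0|rewrite setI0 measure0].
  move=> V W [oV nV] [oW nW]; exists (V `|` W).
    split; first exact: openU.
    rewrite setIUr; apply/eqP; rewrite eq_le measure_ge0 andbT.
    apply: le_trans (measureU2 _ _ _) _.
    + by apply: measurableI => //; exact: open_borel.
    + by apply: measurableI => //; exact: open_borel.
    + by rewrite [X in X + _]nV [X in _ + X]nW adde0.
  by move=> Z VWZ; split => x ?; apply: VWZ; [left|right].
have [|V [oV nV] /(_ V (@subset_refl _ _)) KV] :=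
    (compact_near_coveringP K).1 cK _ NF (fun W x => W x) FNF.
  move=> x /KA/nA[U [oU Ux nU]]; exists (U, [set W | U `<=` W]) => /=.
    by split; [exact: open_nbhs_nbhs|exists U].
  by move=> [y W] [/= Uy]; exact.
rewrite -nV; apply: le_measure; rewrite ?inE.
- by apply: closed_borel; exact: compact_closed.
- by apply: measurableI => //; exact: open_borel.
- by move=> x Kx; split; [exact: KA|exact: KV].
Qed.

End regular.

(** * Trace of a Radon measure on a closed subset *)

Section trace.
Context (R : realType) (X : topologicalType) (x0 : X).
Variable mu : {finite_measure set (borelType x0) -> \bar R}.
Variables (F : set X) (cF : closed F) (z0 : set_type F).

(** Defined on the subspace type, through images, so that the hypothesis [MS] on a fibre applies to
    it. *)
Definition trace_measure (B : set (borelType z0)) : \bar R := mu (set_val @` B).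

Let trace0 : trace_measure set0 = 0.
Proof. by rewrite /trace_measure image_set0 measure0. Qed.

Let trace_ge0 B : 0 <= trace_measure B.
Proof. exact: measure_ge0. Qed.

Let trace_sigma_additive : semi_sigma_additive trace_measure.
Proof.
move=> B mB tB mUB; rewrite /trace_measure image_bigcup.
apply: measure_semi_sigma_additive.
- by move=> n; exact: borel_image_set_val.
- apply/trivIsetP => i j _ _ ij.
  rewrite -subset0 => _ [[x Bix <-] [y Bjy /val_inj yx]].
  have /trivIsetP/(_ i j I I ij) Bij0 := tB.
  suff : (B i `&` B j) x by rewrite Bij0.
  by split => //; rewrite -yx.
- by apply: bigcup_measurable => n _; exact: borel_image_set_val.
Qed.

HB.instance Definition _ :=
  isMeasure.Build _ (borelType z0) R trace_measure
    trace0 trace_ge0 trace_sigma_additive.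

Let trace_fin : fin_num_fun trace_measure.
Proof.
by move=> B mB; apply: fin_num_measure; exact: (@borel_image_set_val _ x0 F z0).
Qed.

HB.instance Definition _ :=
  Measure_isFinite.Build _ (borelType z0) R trace_measure trace_fin.

(** Compact sets inside an image and open sets around it pull back along the inclusion; the former
    stay compact, as closed subsets of the compact subspace. *)
Lemma regular_trace_measure : compact [set: X] -> hausdorff_space X ->
  hausdorff_space (set_type F) -> compact [set: set_type F] -> regular_measure mu ->
  regular_measure (trace_measure : {finite_measure set (borelType z0) -> \bar R}).
Proof.
move=> cX hX hF ctF rmu A mA.
have mA' := borel_image_set_val (x0 := x0) cF mA.
have [muAK muAU] := rmu _ mA'.
have cval : continuous (set_val : set_type F -> X) by exact: initial_continuous.
have imK (K : set X) : K `<=` set_val @` A ->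
    set_val @` (set_val @^-1` K : set (set_type F)) = K.
  move=> KA; apply/seteqP; split=> [_ [x Kx <-]//|x Kx].
  by have [y Ay yx] := KA _ Kx; exists y => //=; rewrite yx.
split; apply/eqP; rewrite eq_le; apply/andP; split.
- rewrite [leLHS]muAK; apply: ge_ereal_sup => _ [K [cK KA] <-].
  apply: ereal_sup_ubound; exists (set_val @^-1` K); last first.
    by rewrite /= /trace_measure imK.
  split; last by move=> x /KA[y Ay /val_inj <-].
  apply: (subclosed_compact _ ctF) => //.
  by apply: (continuous_closedP _).1 => //; exact: compact_closed.
- apply: ge_ereal_sup => _ [K [cK KA] <-].
  apply: le_measure => //; rewrite inE//.
  by apply: closed_borel; exact: compact_closed.
- apply: le_ereal_inf_tmp => _ [U [oU AU] <-].
  apply: le_measure => //; rewrite inE//.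
  exact: open_borel.
- rewrite [leRHS]muAU; apply: le_ereal_inf_tmp => _ [U [oU AU] <-].
  (* The pullback of [U] is a competitor in the infimum, and its image is a part of [U]. *)
  apply: (@le_trans _ _ (trace_measure (set_val @^-1` U))).
    apply: ereal_inf_lbound; exists (set_val @^-1` U) => //; split.
      by exists U.
    by move=> x Ax; apply: AU; exists x.
  apply: le_measure; rewrite ?inE.
  + apply: (borel_image_set_val (z0 := z0)) => //.
    apply: (borel_preimage_set_val (x0 := x0)).
    exact: open_borel.
  + exact: open_borel.
  + by move=> _ [x Ux <-].
Qed.

End trace.

(** The countable family given by separability of the trace is carried to [X] by the inclusion,
    which is injective and so preserves symmetric differences. *)
Lemma MS_approximable (R : realType) (X : topologicalType) (x0 : X)
    (mu : {finite_measure set (borelType x0) -> \bar R}) (F : set X) :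
  compact [set: X] -> hausdorff_space X -> regular_measure mu ->
  closed F -> MS R (set_type F) ->
  exists C : set (set (borelType x0)), [/\ countable C, C `<=` measurable &
    forall A : set (borelType x0),
      measurable A -> A `<=` F -> approximable mu C A].
Proof.
move=> cX hX rmu cF [ctF hF sepF].
(* An empty [F] offers no base point for the trace; there the family containing only the empty set
   serves. *)
have [[z Fz]|/set0P/negP/negPn/eqP F0] := pselect (F !=set0); last first.
  exists [set set0]; split; [exact: countable1|by move=> _ ->|].
  move=> A mA; rewrite F0 subset0 => -> e e0; exists set0 => //.
  by rewrite setYK measure0 lte_fin.
pose z0 : set_type F := SigSub (mem_set Fz).
have [C [cC mC CA]] := (separable_measureP _).1
  (sepF z0 _ (regular_trace_measure cF (z0 := z0) cX hX hF ctF rmu)).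
exists (image C (fun B => set_val @` B)); split.
- exact: sub_countable (card_image_le _ _) cC.
- by move=> _ [B CB <-]; apply: (borel_image_set_val (z0 := z0)) => //; exact: mC.
move=> A mA AF e e0.
have [B CB ABe] := CA _ (borel_preimage_set_val (z0 := z0) mA) _ e0.
exists (set_val @` B); first by exists B.
suff <- : set_val @` ((set_val @^-1` A : set (set_type F)) `+` B) =
    A `+` (set_val @` B).
  exact: ABe.
apply/seteqP; split=> x; rewrite !setY_def.
  move=> [y [[Ay nBy]|[By nAy]] <-]; [left|right]; split => //.
    by move=> [y' By' /val_inj yy']; rewrite -yy' in nBy.
move=> [[Ax nBx]|[[y By yx] nAx]].
  exists (SigSub (mem_set (AF _ Ax))) => //; left; split => // Bx; apply: nBx.
  by exists (SigSub (mem_set (AF _ Ax))).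
by exists y => //; right; split => //=; rewrite yx.
Qed.

(** * Measures mapped to a scattered space *)

(** Meant for the part of the space left when the fibres of positive measure are removed. *)
Lemma scattered_null (R : realType) (X Y : topologicalType) (x0 : X)
    (mu : {finite_measure set (borelType x0) -> \bar R}) (f : X -> Y) (E : set X) :
  hausdorff_space X -> hausdorff_space Y -> scattered Y -> continuous f ->
  regular_measure mu -> measurable (E : set (borelType x0)) ->
  (forall y, mu (E `&` f @^-1` [set y]) = 0) -> mu E = 0.
Proof.
move=> hX hY sY cf rmu mE E0.
have fV (V : set Y) : open V -> open (f @^-1` V).
  by move: V; exact: (continuousP _).1.
(* [S] is the support of the image under [f] of [mu] restricted to [E]. *)
pose S := [set y | forall V, open V -> V y -> mu (E `&` f @^-1` V) != 0].
have nullE (A : set X) : measurable (A : set (borelType x0)) -> A `<=` E ->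
    (forall x, A x -> ~ S (f x)) -> mu A = 0.
  move=> mA AE AS; apply: (locally_null hX rmu mA) => x /AS.
  move=> /existsNP[V /not_implyP[oV /not_implyP[Vfx /negP/negPn/eqP EV0]]].
  exists (f @^-1` V); split => //; first exact: fV.
  apply: (subset_measure0 _ _ _ EV0); last exact: setSI.
    by apply: measurableI => //; apply: open_borel; exact: fV.
  by apply: measurableI => //; apply: open_borel; exact: fV.
have [/sY[y [/set_mem Sy [V]]]|S0] := pselect (S !=set0); last first.
  by apply: nullE => // x _ Sx; apply: S0; exists (f x).
rewrite nbhsE => -[W [oW Wy] WV] VS.
have mW : measurable (E `&` f @^-1` W : set (borelType x0)).
  by apply: measurableI => //; apply: open_borel; exact: fV.
have my : measurable (f @^-1` [set y] : set (borelType x0)).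
  apply: closed_borel; apply: (continuous_closedP _).1 => //.
  exact: accessible_closed_set1 (hausdorff_accessible hY) _.
(* [W] meets [S] only in [y], so the part of [E] over [W] splits into a null fibre and a set mapped
   off [S], null by [nullE]. This contradicts [Sy]. *)
have /negP := Sy _ oW Wy; case; rewrite eq_le measure_ge0 andbT.
apply: (@le_trans _ _ (mu (E `&` f @^-1` [set y] `|`
    (E `&` f @^-1` W) `\` f @^-1` [set y]))).
  apply: le_measure; rewrite ?inE//.
    by apply: measurableU; [exact: measurableI|exact: measurableD].
  by move=> x [Ex Wfx]; have [fxy|fxy] := pselect (f x = y); [left|right].
apply: le_trans (measureU2 _ _ _) _; [exact: measurableI|exact: measurableD|].
rewrite [X in X + _]E0 add0e [leLHS]nullE//.
- exact: measurableD.
- by move=> x [[]].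
move=> x [[Ex Wfx] fxy] Sfx; apply: fxy; rewrite /= -[_ = _]/([set y] (f x)) -VS.
by split => //; exact: WV.
Qed.

Theorem theorem2p9 (R : realType) (X Y : topologicalType) (f : X -> Y)
    (cX : compact [set: X]) (hX : hausdorff_space X)
    (cY : compact [set: Y]) (hY : hausdorff_space Y)
    (sY : scattered Y) (cf : continuous f)
    (fib : forall y : Y, MS R (set_type (f @^-1` [set y]))) :
  MS R X.
Proof.
split => // x0 mu rmu.
have cfib y : closed (f @^-1` [set y]).
  apply: (continuous_closedP _).1 => //.
  exact: accessible_closed_set1 (hausdorff_accessible hY) _.
have mfib y : measurable (f @^-1` [set y] : set (borelType x0)).
  exact: closed_borel.
pose D := [set y | 0 < mu (f @^-1` [set y])].
have cD : countable D.
  by apply: countable_positive_measure => //; exact: trivIset_preimage1.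
have [e eD] := countable_injP _ cD.
(* The code [e], injective on [D], enumerates the fibres of positive measure; a number that codes no
   point of [D] yields the empty set. *)
pose P n := \bigcup_(y in [set y | D y /\ e y = n]) f @^-1` [set y].
have P_or n : P n = set0 \/ exists y, P n = f @^-1` [set y].
  have [[y [Dy eyn]]|Dn0] :=
      pselect ([set y | D y /\ e y = n] !=set0); last first.
    left; rewrite /P (_ : mkset _ = set0) ?bigcup_set0//.
    by apply/seteqP; split=> // y Dy; apply: Dn0; exists y.
  right; exists y; rewrite /P (_ : mkset _ = [set y]) ?bigcup_set1//.
  apply/seteqP; split=> [z [Dz ezn]|_ ->//].
  by apply: eD; rewrite ?inE// ezn.
have mP n : measurable (P n : set (borelType x0)).
  by have [->|[y ->]] := P_or n.
have mE : measurable (~` \bigcup_n P n : set (borelType x0)).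
  by apply: measurableC; exact: bigcup_measurable.
apply: (@separable_measure_cover _ _ _ mu P) => //.
- apply: (scattered_null hX hY sY cf rmu mE) => y.
  (* A fibre over [D] misses the complement of the pieces, and any other fibre is null by the choice
     of [D]. *)
  have [Dy|nDy] := pselect (D y).
    rewrite (_ : _ `&` _ = set0) ?measure0//.
    apply/seteqP; split=> // x [nPx fxy].
    by apply: nPx; exists (e y) => //; exists y.
  apply/eqP; rewrite eq_le measure_ge0 andbT.
  apply: le_trans (_ : mu (f @^-1` [set y]) <= 0).
    by apply: le_measure; rewrite ?inE//; exact: measurableI.
  by rewrite leNgt; apply/negP.
move=> n; have [->|[y ->]] := P_or n; last exact: MS_approximable.
exists [set set0]; split; [exact: countable1|by move=> _ ->|].
move=> A mA; rewrite subset0 => -> r r0; exists set0 => //.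
by rewrite setYK measure0 lte_fin.
Qed.
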